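(* Let $n \geq 4$ and let $a,b$ be positive integers. Then the sequence $h=(h_0,h_1,\ldots,h_n)\in \mathbb{Z}_{>0}^{n+1}$ with $h_0=1$, $h_1=h_2=\cdots=h_{n-1}=a$ and $h_n=b$ (i.e. $h=(1,a,a,\ldots,a,b)$) is a pure $O$-sequence if and only if $b \leq a \leq 2b$.
   Context: Monomials are in finitely many indeterminates $x_1,\ldots,x_s$ (any $s$), each of degree $1$. An order ideal of monomials is a nonempty finite set $\mathcal{A}$ of monomials such that whenever $u\in\mathcal{A}$ and $v$ is a monomial dividing $u$, then $v\in\mathcal{A}$. It is pure if all its maximal elements with respect to divisibility have the same degree. Its $h$-vector is $h(\mathcal{A})=(h_0,\ldots,h_n)$ where $n=\max\{\deg u: u\in\mathcal{A}\}$ and $h_i$ is the number of elements of $\mathcal{A}$ of degree $i$. A finite sequence of positive integers is a pure $O$-sequence if it equals $h(\mathcal{A})$ for some pure order ideal of monomials $\mathcal{A}$ (in some number of variables). *)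

(* Defs.v *)
From HB Require Import structures.
From mathcomp Require Import all_boot all_order all_algebra finmap.
From mathcomp.multinomials Require Import mpoly.

Set Implicit Arguments.
Unset Strict Implicit.
Unset Printing Implicit Defensive.

Local Open Scope fset_scope.

(* Divisibility of monomials is the pointwise order [(_ <= _)%MM] on exponent
   vectors (not the total monomial order [(_ <= _)%O]). *)
Definition order_ideal (s : nat) (A : {fset 'X_{1..s}}) : Prop :=
  A != fset0 /\
  forall u v : 'X_{1..s}, u \in A -> (v <= u)%MM -> v \in A.

Definition maximal_in (s : nat) (A : {fset 'X_{1..s}}) (u : 'X_{1..s}) : Prop :=
  u \in A /\ forall v : 'X_{1..s}, v \in A -> (u <= v)%MM -> v = u.

Definition pure (s : nat) (A : {fset 'X_{1..s}}) : Prop :=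
  forall u v : 'X_{1..s}, maximal_in A u -> maximal_in A v -> mdeg u = mdeg v.

Definition max_deg (s : nat) (A : {fset 'X_{1..s}}) : nat :=
  \max_(u <- A) mdeg u.

Definition h_vector (s : nat) (A : {fset 'X_{1..s}}) : seq nat :=
  mkseq (fun i => #|` [fset u in A | mdeg u == i]|) (max_deg A).+1.

Definition pure_O_sequence (h : seq nat) : Prop :=
  all (leq 1) h /\
  exists (s : nat) (A : {fset 'X_{1..s}}),
    [/\ order_ideal A, pure A & h_vector A = h].

(* Main.v *)
(**
View the degree-2 monomials of A as the edges (with loops for squares) of a
graph on the variables of A; it has as many edges as vertices.  A variable that
is neither looped nor adjacent to a looped one only divides squarefree monomials,
one of them of degree n >= 4, hence has at least three neighbours; counting
edges then shows that there is no such variable, and that besides the loops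
every unlooped variable i lies on exactly one edge, which joins it to a looped
variable x(i).  Put x(i) = i when i is looped.  Then each monomial of degree n
is x_i * x_(x(i))^(n-1) for some i.  There are at most a of these, so b <= a;
each involves at most two variables while every variable divides one, so
a <= 2b.

Conversely, a - b monomials x^(n-1) y and 2b - a monomials x^n in disjoint sets
of variables generate a pure order ideal with the required h-vector.
*)
Require Import Defs.
From mathcomp Require Import all_boot all_order all_algebra finmap.
From mathcomp.multinomials Require Import mpoly.
From mathcomp Require Import zify.

(** * Degree slices, cardinality bounds and divisibility of monomials *)

Definition graded {s : nat} (A : {fset 'X_{1..s}}) (d : nat) : {fset 'X_{1..s}} :=
  [fset u in A | mdeg u == d]%fset.

Lemma in_graded {s : nat} (A : {fset 'X_{1..s}}) d u :
  (u \in graded A d) = (u \in A) && (mdeg u == d).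
Proof. by rewrite /graded !inE. Qed.

Lemma leq_card_fset (I : finType) (T : choiceType) (P : {set I}) (f : I -> T)
    (B : {fset T}) :
  {in P &, injective f} -> (forall i, i \in P -> f i \in B) -> #|P| <= #|` B|.
Proof.
move=> injf fB; rewrite cardE -(size_map f); apply: uniq_leq_size.
  rewrite map_inj_in_uniq ?enum_uniq // => i j; rewrite !mem_enum; exact: injf.
by move=> _ /mapP[i + ->]; rewrite mem_enum; exact: fB.
Qed.

Lemma card_fset_leq (I : finType) (T : choiceType) (P : {set I}) (f : I -> T)
    (B : {fset T}) :
  (forall u, u \in B -> exists2 i, i \in P & u = f i) -> #|` B| <= #|P|.
Proof.
move=> Bf; rewrite [#|P|]cardE -(size_map f); apply: uniq_leq_size.
  exact: fset_uniq.
by move=> u /Bf[i Pi ->]; rewrite map_f // mem_enum.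
Qed.

Lemma seq_argmax (T : eqType) (f : T -> nat) (r : seq T) (u : T) :
  u \in r -> exists2 t, t \in r & forall v, v \in r -> f v <= f t.
Proof.
move=> ur; have ex : exists d, d \in map f r by exists (f u); exact: map_f.
have ub d : d \in map f r -> d <= \max_(v <- r) f v.
  by case/mapP=> v vr ->; exact: leq_bigmax_seq.
case: (ex_maxnP ex ub) => d /mapP[t tr ->] maxt; exists t => // v vr.
by apply: maxt; exact: map_f.
Qed.

Lemma lepm_mdeg_eq {s : nat} (u v : 'X_{1..s}) :
  (u <= v)%MM -> mdeg v <= mdeg u -> v = u.
Proof.
move=> le_uv; rewrite -{1}(submK le_uv) mdegD => le_d.
have /eqP : mdeg (v - u) = 0 by lia.
by rewrite mdeg_eq0 => /eqP e; rewrite -(submK le_uv) e add0m.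
Qed.

Lemma leq_mnm_mdeg {s : nat} (t : 'X_{1..s}) i : t i <= mdeg t.
Proof. by rewrite mdegE (bigD1 i) //= leq_addr. Qed.

Lemma leq_mnm2_mdeg {s : nat} (t : 'X_{1..s}) i j :
  i != j -> t i + t j <= mdeg t.
Proof.
move=> ij; rewrite mdegE (bigD1 i) //= (bigD1 j) 1?eq_sym //=.
by rewrite addnA leq_addr.
Qed.

Lemma mdeg_gt0_ex {s : nat} (t : 'X_{1..s}) :
  0 < mdeg t -> exists i, 0 < t i.
Proof.
move=> t0; apply/existsP; apply: contraLR t0 => /existsPn t0.
rewrite lt0n negbK mdeg_eq0; apply/eqP/mnmP=> i; rewrite mnm0E.
by move: (t0 i); lia.
Qed.

Lemma pair_lepm {s : nat} (t : 'X_{1..s}) i j :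
  i != j -> 0 < t i -> 0 < t j -> (U_(i) + U_(j) <= t)%MM.
Proof.
move=> /negPf ij ti tj; apply/mnm_lepP=> k; rewrite mnmDE !mnm1E.
case: (eqVneq i k) => [<-|_]; first by rewrite eq_sym ij.
by case: (eqVneq j k) => [<-|].
Qed.

Lemma square_lepm {s : nat} (t : 'X_{1..s}) i :
  1 < t i -> (U_(i) + U_(i) <= t)%MM.
Proof.
move=> ti; apply/mnm_lepP=> k; rewrite mnmDE !mnm1E.
by case: (eqVneq i k) => [<-|].
Qed.

(** A multiple of [u] of largest degree in [A] is maximal, and so is an element of largest degree in
    [A]; purity equates their degrees. *)
Lemma divides_top {s : nat} (A : {fset 'X_{1..s}}) (u : 'X_{1..s}) :
  pure A -> u \in A ->
  exists2 t, t \in graded A (max_deg A) & (u <= t)%MM.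
Proof.
move=> pA uA.
have [w wA wmax] := @seq_argmax _ (@mdeg s) A u uA.
have : u \in [fset v in A | (u <= v)%MM]%fset by rewrite !inE uA lepm_refl.
move/(@seq_argmax _ (@mdeg s)) => [t]; rewrite !inE => /andP[tA ut] tmax.
have mt : maximal_in A t.
  split=> // v vA tv; apply: (lepm_mdeg_eq _ _ tv); apply: tmax.
  by rewrite !inE vA (lepm_trans ut tv).
have mw : maximal_in A w.
  by split=> // v vA wv; apply: (lepm_mdeg_eq _ _ wv); exact: wmax.
exists t => //; rewrite in_graded tA (pA _ _ mt mw) eqn_leq.
rewrite leq_bigmax_seq //=; apply/bigmax_leqP_seq => v vA _; exact: wmax.
Qed.

(* The monomial x_k * x_(x k)^d of degree d + 1; it is a pure power if x k = k. *)
Definition star {s : nat} (x : 'I_s -> 'I_s) (d : nat) (k : 'I_s) : 'X_{1..s} :=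
  (U_(k) + U_(x k) *+ d)%MM.

Lemma starE {s : nat} (x : 'I_s -> 'I_s) d k j :
  star x d k j = (k == j) + (x k == j) * d.
Proof. by rewrite /star mnmDE mulmnE !mnm1E. Qed.

Lemma mdeg_star {s : nat} (x : 'I_s -> 'I_s) d k : mdeg (star x d k) = d.+1.
Proof. by rewrite /star mdegD mdegMn !mdeg1 mul1n. Qed.

Lemma star1 {s : nat} (x : 'I_s -> 'I_s) k :
  star x 1 k = (U_(k) + U_(x k))%MM.
Proof. by rewrite /star mulm1n. Qed.

(** If [k] and [l] differ, comparing exponents at both forces [x l = k] and [x k = l], and
    idempotence makes them equal. *)
Lemma star_inj {s : nat} (x : 'I_s -> 'I_s) d :
  (forall k, x (x k) = x k) -> injective (star x d).
Proof.
move=> xx k l /mnmP e; apply/eqP; apply/negPn/negP=> kl.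
move: (e k) (e l); rewrite !starE !eqxx (negPf kl) [l == k]eq_sym (negPf kl).
case: (eqVneq (x l) k) => [xl _|_ ]; last by lia.
case: (eqVneq (x k) l) => [xk _|_ ]; last by lia.
by move: kl; rewrite -xk -[in X in X != _]xl -xx xl eqxx.
Qed.

Lemma card_graded1 {s : nat} (A : {fset 'X_{1..s}}) :
  #|` graded A 1| = #|[set i | U_(i)%MM \in A]|.
Proof.
apply/eqP; rewrite eqn_leq; apply/andP; split.
  apply: (@card_fset_leq _ _ _ (fun i => U_(i)%MM)) => u.
  rewrite in_graded => /andP[uA /mdeg1P[i /eqP eu]].
  by exists i; rewrite // inE -eu.
apply: (@leq_card_fset _ _ _ (fun i => U_(i)%MM)) => [i j _ _ /eqP|i].
  by rewrite eq_mnm1 => /eqP.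
by rewrite inE in_graded mdeg1 eqxx andbT.
Qed.

(** * Necessity: the graph of degree-two monomials *)

Lemma top_star {s : nat} (A : {fset 'X_{1..s}}) (n : nat) :
  4 <= n -> order_ideal A ->
  (forall u, u \in A -> exists2 t, t \in graded A n & (u <= t)%MM) ->
  #|` graded A 1| = #|` graded A 2| ->
  exists x : 'I_s -> 'I_s, forall t, t \in graded A n ->
    exists2 i, U_(i)%MM \in A & t = star x n.-1 i.
Proof.
move=> n4 [_ idA] topA h12.
pose V := [set i | U_(i)%MM \in A].
pose e i j := (U_(i) + U_(j))%MM \in A.
have eV i j : e i j -> i \in V.
  by rewrite inE => eij; apply: (idA _ _ eij); exact: lem_addr.
(* The default [i] keeps [x] idempotent when there is no looped neighbour; the loop test in [G]
   excludes such [i]. *)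
pose x i := if e i i then i else odflt i [pick j | e j j && e i j].
(* The variables whose square lies in A, together with their neighbours. *)
pose G := [set i | e (x i) (x i) && e i (x i)].
have xL i : e i i -> x i = i by rewrite /x => ->.
have xx i : x (x i) = x i.
  suff : e (x i) (x i) \/ x i = i by case=> [/xL|xi] //; rewrite !xi.
  rewrite /x; case: ifP => [|_]; first by left.
  by case: pickP => [j /andP[]|]; [left|right].
have inG i j : e j j -> e i j -> i \in G.
  move=> ej eij; rewrite inE /x; case: ifP => [-> //|_].
  by case: pickP => [k|/(_ j)] //=; rewrite ej eij.
have LG i : e i i -> i \in G by move=> ei; exact: (inG _ _ ei ei).
have GV : G \subset V by apply/subsetP=> i; rewrite inE => /andP[_ /eV].
pose B := [fset star x 1 i | i in G]%fset.
have cB : #|` B| = #|G|.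
  apply/eqP; rewrite eqn_leq; apply/andP; split.
    apply: (@card_fset_leq _ _ _ (star x 1)) => u /imfsetP[i /= Gi ->].
    by exists i.
  apply: (@leq_card_fset _ _ _ (star x 1)) => [i j _ _|i Gi].
    exact: star_inj.
  by apply/imfsetP; exists i.
have BA2 : (B `<=` graded A 2)%fset.
  apply/fsubsetP => u /imfsetP[i /=]; rewrite inE => /andP[_ ei] ->.
  by rewrite in_graded mdeg_star star1 eqxx andbT.
(* [B] has one edge per vertex of [G], so [h12] leaves as many edges in [R] as vertices in [N]. *)
pose R := (graded A 2 `\` B)%fset.
pose N := V :\: G.
have cN : #|` R| = #|N|.
  rewrite /R cardfsDS // cB -h12 card_graded1 cardsD.
  by rewrite (setIidPr GV).
(* An exponent above 1 in a degree-[n] multiple [t] of the variable [i] would put [i] in [G], so [t]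
   is squarefree and gives [i] at least [n - 1] neighbours. The edges to them avoid [B], whose edges
   have both ends in [G]. *)
have dN i : i \in N -> 3 <= \sum_(m <- R) m i.
  rewrite inE => /andP[nGi]; rewrite inE => Vi.
  have [t] := topA _ Vi; rewrite in_graded => /andP[tA /eqP dt] le_t.
  have ti : 0 < t i by move/mnm_lepP/(_ i): le_t; rewrite mnm1E eqxx.
  have t1 j : t j <= 1.
    rewrite leqNgt; apply/negP => tj.
    have ejj : e j j by apply: (idA _ _ tA); exact: square_lepm.
    case: (eqVneq i j) => [ij|ij]; first by rewrite ij LG in nGi.
    move/negP: nGi; apply; apply: (inG _ _ ejj); apply: idA tA _.
    by apply: pair_lepm => //; lia.
  pose J := [set j | (j != i) && (0 < t j)].
  have J3 : 3 <= #|J|.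
    suff : n <= 1 + #|J| by lia.
    rewrite -dt mdegE -(mdeg1 i) mdegE -sum1_card [X in _ + X]big_mkcond.
    rewrite -big_split /=; apply: leq_sum => j _; rewrite mnm1E inE eq_sym.
    by move: (t1 j); case: eqP; case: (t j) => [|[]].
  apply: (leq_trans J3).
  apply: (@leq_trans (count (fun m : 'X_{1..s} => 0 < m i) R)); last first.
    rewrite -sum1_count big_mkcond; apply: leq_sum => m _.
    by case: ifP.
  rewrite -size_filter cardE -(size_map (fun j => (U_(i) + U_(j))%MM)).
  apply: uniq_leq_size.
    rewrite map_inj_uniq ?enum_uniq // => j k /mnmP/(_ k).
    rewrite !mnmDE !mnm1E eqxx; case: (eqVneq j k) => // _; lia.
  move=> _ /mapP[j + ->]; rewrite mem_enum inE => /andP[ji tj].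
  rewrite mem_filter mnmDE !mnm1E eqxx /= in_fsetD in_graded mdegD !mdeg1.
  rewrite eqxx andbT; apply/andP; split; last first.
    by apply: (idA _ _ tA); apply: pair_lepm; rewrite // eq_sym.
  apply/negP=> /imfsetP[k /= Gk /mnmP/(_ i)].
  rewrite mnmDE !mnm1E starE eqxx.
  case: (eqVneq k i) => [ki|_]; first by rewrite -ki Gk in nGi.
  case: (eqVneq (x k) i) => [ki _|_]; last by lia.
  by move: Gk nGi; rewrite inE ki => /andP[/LG ->].
(* Count the pairs (i, m) with i in N and i dividing m in R: each i occurs at
   least three times and each m at most twice, so #|R| = #|N| forces both to
   be empty. *)
have : #|N| * 3 <= #|` R| * 2.
  rewrite -sum_nat_const (leq_trans (leq_sum _ dN)) //.
  rewrite exchange_big /= card_fset_sum1 big_distrl /= big_seq [X in _ <= X]big_seq.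
  apply: leq_sum => m; rewrite in_fsetD in_graded mul1n => /and3P[_ _ /eqP <-].
  by rewrite mdegE [X in _ <= X](bigID (mem N)) leq_addr.
rewrite cN => N0; have {}N0 : #|N| = 0 by lia.
have R0 : #|` R| = 0 by rewrite cN.
have VG i : U_(i)%MM \in A -> i \in G.
  move=> Vi; move/cards0_eq/setP/(_ i): N0; rewrite !inE Vi andbT.
  by move/negbFE.
have A2 i j : e i j -> exists2 k, k \in G & (U_(i) + U_(j))%MM = star x 1 k.
  move=> eij; move/cardfs0_eq/fsetP/(_ (U_(i) + U_(j))%MM): R0.
  rewrite in_fsetD in_graded mdegD !mdeg1 -/(e i j) eij eqxx !andbT in_fset0 => /negbFE.
  by case/imfsetP=> k /= Gk ->; exists k.
(* The edge is [star x 1 k] with [k = i]: otherwise [x k = i], and [i] would be looped because [k]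
   is in [G]. *)
have nbrM i z : ~~ e i i -> e i z -> z = x i.
  move=> nei eiz; have [k Gk /mnmP E] := A2 _ _ eiz.
  have ki : k = i.
    move: (E i); rewrite mnmDE !mnm1E starE eqxx.
    case: (eqVneq k i) => // _; case: (eqVneq (x k) i) => [ki|_]; last by lia.
    by move: Gk nei; rewrite inE ki => /andP[->].
  move: (E z); rewrite mnmDE !mnm1E starE eqxx ki.
  by case: (eqVneq (x i) z) => // _; lia.
(* Here [k] would be one of the two looped ends, so [x k = k] and the edge would be a loop. *)
have nbrL i j : e i i -> e j j -> e i j -> i = j.
  move=> ei ej eij; apply/eqP/negPn/negP=> ij.
  have [k Gk /mnmP E] := A2 _ _ eij.
  move: (E i) (E j); rewrite !starE !mnmDE !mnm1E !eqxx (negPf ij).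
  rewrite [j == i]eq_sym (negPf ij).
  case: (eqVneq k i) => [->|_]; first by rewrite (xL _ ei) (negPf ij).
  case: (eqVneq (x k) i) => [xk|_]; last by lia.
  rewrite xk (negPf ij); case: (eqVneq k j) => [kj|_]; last by lia.
  by move: ij; rewrite -xk kj (xL _ ej) eqxx.
exists x => t; rewrite in_graded => /andP[tA /eqP dt].
have sq i : 1 < t i -> e i i.
  by move=> ti; apply: (idA _ _ tA); exact: square_lepm.
have pr i j : i != j -> 0 < t i -> 0 < t j -> e i j.
  by move=> ij ti tj; apply: (idA _ _ tA); exact: pair_lepm.
have tV i : 0 < t i -> U_(i)%MM \in A.
  move=> ti; apply: (idA _ _ tA); apply/mnm_lepP=> k; rewrite mnm1E.
  by case: eqP => // <-.
(* Both monomials have degree [n], so divisibility already gives equality. *)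
have toStar i : (forall z, t z <= star x n.-1 i z) -> t = star x n.-1 i.
  move=> le_t; symmetry; apply: lepm_mdeg_eq; first exact/mnm_lepP.
  by rewrite mdeg_star dt; lia.
(* An unlooped [i] in [t] has exponent 1 and only [x i] beside it; if all variables of [t] are
   looped, [nbrL] leaves just one. *)
case: (boolP [exists i, (0 < t i) && ~~ e i i]) => [/existsP[i /andP[ti nei]]|].
  exists i; first exact: tV.
  apply: toStar => z; rewrite starE.
  have ti1 : t i <= 1 by rewrite leqNgt; apply: contra nei; exact: sq.
  case: (eqVneq i z) => [<-|iz]; first by lia.
  case: (posnP (t z)) => [-> //|tz].
  rewrite -(nbrM i z nei (pr i z iz ti tz)) eqxx.
  by move: (leq_mnm2_mdeg t i z iz); lia.
move/existsPn=> allL.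
have [|i ti] := mdeg_gt0_ex t; first by lia.
have Ls z : 0 < t z -> e z z by move=> tz; move: (allL z); rewrite tz negbK.
exists i; first exact: tV.
apply: toStar => z; rewrite starE (xL _ (Ls _ ti)).
case: (eqVneq i z) => [<-|iz].
  by move: (leq_mnm_mdeg t i); lia.
case: (posnP (t z)) => [-> //|tz].
by have := iz; rewrite (nbrL i z (Ls _ ti) (Ls _ tz) (pr _ _ iz ti tz)) eqxx.
Qed.

Lemma pure_flat_bounds {s : nat} (A : {fset 'X_{1..s}}) :
  4 <= max_deg A -> order_ideal A -> pure A ->
  #|` graded A 1| = #|` graded A 2| ->
  #|` graded A (max_deg A)| <= #|` graded A 1|
    <= 2 * #|` graded A (max_deg A)|.
Proof.
move=> n4 oA pA h12.
have topA u := @divides_top s A u pA.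
have [x starA] := top_star A _ n4 oA topA h12.
rewrite !card_graded1; apply/andP; split.
  apply: (@card_fset_leq _ _ _ (star x (max_deg A).-1)) => u /starA[i Vi ->].
  by exists i; rewrite // inE.
(* Double counting of the pairs of a variable and a top monomial that it divides. *)
rewrite mulnC card_fset_sum1 big_distrl /= -sum1_card.
apply: (@leq_trans (\sum_(i in [set i | U_(i)%MM \in A])
   \sum_(t <- graded A (max_deg A)) (0 < t i))).
  apply: leq_sum => i; rewrite inE => /topA[t tT /mnm_lepP/(_ i)].
  by rewrite mnm1E eqxx (big_rem t) //= => ->.
rewrite exchange_big /= big_seq [X in _ <= X]big_seq.
apply: leq_sum => t /starA[i _ ->].
(* The factor 2 is written as the degree of [star x 1 i], whose exponents bound the support of the
   top monomial. *)
rewrite mul1n -(mdeg_star x 1 i) mdegE big_mkcond /=.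
apply: leq_sum => j _; rewrite !starE.
by case: ifP => // _; case: (i == j); case: (x i == j); lia.
Qed.

Lemma nth_h_vector {s : nat} (A : {fset 'X_{1..s}}) i :
  i <= max_deg A -> nth 0 (h_vector A) i = #|` graded A i|.
Proof. by move=> le_i; rewrite nth_mkseq. Qed.

(** * Sufficiency: the explicit order ideal *)

Lemma fold_ord_subproof (a b : nat) (k : 'I_a) :
  k - (if k < b then 0 else b) < a.
Proof. exact: leq_ltn_trans (leq_subr _ _) (ltn_ord k). Qed.

(** The map [x] of the construction: indices below [b] are fixed, later ones are attached to
    [k - b]. *)
Definition fold_ord (a b : nat) (k : 'I_a) : 'I_a :=
  Ordinal (fold_ord_subproof a b k).

Lemma fold_ord_small (a b : nat) (k : 'I_a) : k < b -> fold_ord a b k = k.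
Proof. by move=> kb; apply: val_inj; rewrite /= kb subn0. Qed.

Lemma fold_ord_lt (a b : nat) (k : 'I_a) : a <= 2 * b -> fold_ord a b k < b.
Proof. by move=> ab /=; case: ifP; move: (ltn_ord k); lia. Qed.

Lemma fold_ord_idem (a b : nat) (k : 'I_a) :
  a <= 2 * b -> fold_ord a b (fold_ord a b k) = fold_ord a b k.
Proof. by move=> ab; rewrite fold_ord_small // fold_ord_lt. Qed.

(* The divisors of x_k^(n-1) * x_(k+b) for k < a - b and of x_k^n for
   a - b <= k < b: a monomial of degree d + 1 is [star _ d k], where k >= b
   stands for x_(k-b)^d * x_k. *)
Definition star_ideal (n a b : nat) : {fset 'X_{1..a}} :=
  (0%MM |` [fset star (fold_ord a b) p.1 p.2 | p : 'I_n * 'I_a in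
     [set p : 'I_n * 'I_a | (p.1.+1 < n) || (a - b <= p.2)]])%fset.

Lemma star_idealP (n a b : nat) (u : 'X_{1..a}) :
  reflect (u = 0%MM \/ exists (d : nat) (k : 'I_a),
             [/\ d < n, (d.+1 < n) || (a - b <= k)
               & u = star (fold_ord a b) d k])
          (u \in star_ideal n a b).
Proof.
rewrite in_fset1U; apply: (iffP orP) => [[/eqP|/imfsetP[[d k] /=]]|].
- by left.
- by rewrite inE /= => dk ->; right; exists d, k; rewrite ltn_ord.
- case=> [->|[d [k [dn dk ->]]]]; [by left; rewrite eqxx|right].
  by apply/imfsetP; exists (Ordinal dn, k); rewrite //= inE.
Qed.

Lemma order_ideal_star_ideal (n a b : nat) :
  a <= 2 * b -> order_ideal (star_ideal n a b).
Proof.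
move=> ab; split.
  by apply/fset0Pn; exists 0%MM; apply/star_idealP; left.
move=> u v /star_idealP[->|[d [k [dn dk ->]]]] /mnm_lepP le_v.
  apply/star_idealP; left; apply/mnmP=> j; move: (le_v j).
  by rewrite mnm0E; lia.
have v0 j : k != j -> fold_ord a b k != j -> v j = 0.
  by move=> /negPf kj /negPf xj; move: (le_v j); rewrite starE kj xj; lia.
apply/star_idealP.
case: (eqVneq v 0%MM) => [->|nz]; [by left|right].
case: (eqVneq (fold_ord a b k) k) => [xk|xk].
  have vk : v k <= d.+1 by move: (le_v k); rewrite starE xk eqxx; lia.
  have vk0 : 0 < v k.
    rewrite lt0n; apply: contra nz => /eqP vk0; apply/eqP/mnmP=> j.
    rewrite mnm0E; case: (eqVneq k j) => [<- //|kj].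
    by apply: v0; rewrite ?xk.
  exists (v k).-1, k; split; [lia|by case/orP: dk => [?|->]; rewrite ?orbT; lia|].
  apply/mnmP=> j; rewrite starE xk; case: (eqVneq k j) => [<-|kj]; first by lia.
  by rewrite v0 ?xk.
have vk : v k <= 1 by move: (le_v k); rewrite starE eqxx (negPf xk); lia.
have vx : v (fold_ord a b k) <= d.
  by move: (le_v (fold_ord a b k)); rewrite starE eqxx eq_sym (negPf xk); lia.
(* Without the variable [k], [v] is a power of its attached variable. That index may be below
   [a - b], but the degree of [v] is at most [d < n]. *)
case: (posnP (v k)) => [vk0|vk0].
  have vx0 : 0 < v (fold_ord a b k).
    rewrite lt0n; apply: contra nz => /eqP vx0; apply/eqP/mnmP=> j.
    rewrite mnm0E; case: (eqVneq k j) => [<- //|kj].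
    by case: (eqVneq (fold_ord a b k) j) => [<- //|]; exact: v0.
  exists (v (fold_ord a b k)).-1, (fold_ord a b k); split; try lia.
  apply/mnmP=> j; rewrite starE fold_ord_idem //.
  case: (eqVneq (fold_ord a b k) j) => [<-|xj]; first by lia.
  case: (eqVneq k j) => [<- //|kj]; exact: v0.
exists (v (fold_ord a b k)), k; split; first by lia.
  by case/orP: dk => [?|->]; rewrite ?orbT //; lia.
apply/mnmP=> j; rewrite starE.
case: (eqVneq k j) => [<-|kj]; first by rewrite (negPf xk); lia.
case: (eqVneq (fold_ord a b k) j) => [<-|xj]; [lia|exact: v0].
Qed.

Lemma star_ideal_top (n a b : nat) (u : 'X_{1..a}) :
  0 < n -> 0 < b -> b <= a <= 2 * b -> u \in star_ideal n a b ->
  exists2 t, t \in graded (star_ideal n a b) n & (u <= t)%MM.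
Proof.
move=> n0 b0 /andP[ba ab] uA.
have topA (k : 'I_a) : a - b <= k -> star (fold_ord a b) n.-1 k
    \in graded (star_ideal n a b) n.
  move=> kb; rewrite in_graded mdeg_star prednK // eqxx andbT.
  by apply/star_idealP; right; exists n.-1, k; rewrite kb orbT; split=> //; lia.
case/star_idealP: uA => [->|[d [k [dn dk ->]]]].
  have la : a.-1 < a by lia.
  exists (star (fold_ord a b) n.-1 (Ordinal la)); first by apply: topA => /=; lia.
  by apply/mnm_lepP=> j; rewrite mnm0E.
case: (leqP (a - b) k) dk => [kb _|kb].
  exists (star (fold_ord a b) n.-1 k); first exact: topA.
  by apply/mnm_lepP=> j; rewrite !starE leq_add2l leq_mul2l; apply/orP; right; lia.
(* For [k < a - b] the power of [k] has degree below [n], so it divides the generator indexed by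
   [k + b]. *)
rewrite orbF => dn1; have lk : k + b < a by lia.
exists (star (fold_ord a b) n.-1 (Ordinal lk)); first by apply: topA => /=; lia.
have -> : star (fold_ord a b) d k = star (fun=> k) d k.
  by rewrite /star fold_ord_small //; lia.
have xl : fold_ord a b (Ordinal lk) = k.
  by apply: val_inj => /=; rewrite ltnNge leq_addl /= addnK.
apply/mnm_lepP=> j; rewrite !starE xl; case: (eqVneq k j) => _; lia.
Qed.

Lemma mdeg_star_ideal (n a b : nat) (u : 'X_{1..a}) :
  u \in star_ideal n a b -> mdeg u <= n.
Proof.
by case/star_idealP=> [->|[d [k [dn _ ->]]]]; rewrite ?mdeg0 ?mdeg_star.
Qed.

Lemma max_deg_star_ideal (n a b : nat) :
  0 < n -> 0 < b -> b <= a <= 2 * b -> max_deg (star_ideal n a b) = n.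
Proof.
move=> n0 b0 ab; apply/eqP; rewrite eqn_leq; apply/andP; split.
  by apply/bigmax_leqP_seq => u /mdeg_star_ideal.
have zA : 0%MM \in star_ideal n a b by apply/star_idealP; left.
have [t] := star_ideal_top _ _ _ _ n0 b0 ab zA.
rewrite in_graded => /andP[tA /eqP dt] _.
by rewrite -[X in X <= _]dt leq_bigmax_seq.
Qed.

Lemma pure_star_ideal (n a b : nat) :
  0 < n -> 0 < b -> b <= a <= 2 * b -> pure (star_ideal n a b).
Proof.
move=> n0 b0 ab.
suff deg u : maximal_in (star_ideal n a b) u -> mdeg u = n.
  by move=> u v /deg-> /deg->.
case=> uA umax; have [t] := star_ideal_top _ _ _ _ n0 b0 ab uA.
by rewrite in_graded => /andP[tA /eqP <-] /umax ->.
Qed.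

Lemma card_graded_star_ideal (n a b d : nat) :
  a <= 2 * b -> d < n ->
  #|` graded (star_ideal n a b) d.+1|
    = #|[set k : 'I_a | (d.+1 < n) || (a - b <= k)]|.
Proof.
move=> ab dn; apply/eqP; rewrite eqn_leq; apply/andP; split.
  apply: (@card_fset_leq _ _ _ (star (fold_ord a b) d)) => u.
  rewrite in_graded => /andP[/star_idealP[->|[d' [k [_ dk ->]]]]].
    by rewrite mdeg0.
  by rewrite mdeg_star => /eqP[<-]; exists k; rewrite // inE.
apply: (@leq_card_fset _ _ _ (star (fold_ord a b) d)) => [i j _ _|k].
  by apply: star_inj => k; exact: fold_ord_idem.
rewrite inE in_graded mdeg_star eqxx andbT => dk.
by apply/star_idealP; right; exists d, k.
Qed.

Lemma card_ord_geq (a c : nat) : #|[set k : 'I_a | c <= k]| = a - c.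
Proof.
rewrite -sum1_card (eq_bigl (fun k : 'I_a => true && (c <= k))) => [|k].
  by rewrite -(big_geq_mkord _ _ xpredT (fun=> 1)) sum_nat_const_nat muln1.
by rewrite inE.
Qed.

Lemma h_vector_star_ideal (n a b : nat) :
  0 < n -> 0 < b -> b <= a <= 2 * b ->
  h_vector (star_ideal n a b) = 1 :: rcons (nseq n.-1 a) b.
Proof.
move=> n0 b0 ab; have /andP[ba a2b] := ab.
have dn := max_deg_star_ideal _ _ _ n0 b0 ab.
apply: (@eq_from_nth _ 0); rewrite size_mkseq dn.
  by rewrite /= size_rcons size_nseq prednK.
move=> [|d] dle; rewrite nth_h_vector ?dn //=.
  have -> : graded (star_ideal n a b) 0 = [fset 0%MM]%fset.
    apply/fsetP=> u; rewrite in_graded in_fset1 mdeg_eq0 andb_idl // => /eqP ->.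
    by apply/star_idealP; left.
  exact: cardfs1.
rewrite card_graded_star_ideal // nth_rcons size_nseq nth_nseq.
case: (ltnP d n.-1) => dn1.
  rewrite (_ : [set _ | _] = setT) ?cardsT ?card_ord //.
  by apply/setP=> k; rewrite !inE (_ : d.+1 < n) //; lia.
(* In degree [n] only the indices from [a - b] on survive, and [a - (a - b) = b]. *)
rewrite (_ : d == n.-1); last by lia.
rewrite (_ : d.+1 < n = false) /=; last by lia.
by rewrite card_ord_geq subKn.
Qed.

Theorem theoremA (n a b : nat) (hn : 4 <= n) (ha : 0 < a) (hb : 0 < b) :
  pure_O_sequence (1 :: rcons (nseq n.-1 a) b) <-> b <= a <= 2 * b.
Proof.
have n0 : 0 < n by lia.
split=> [[_ [s [A [oA pA hA]]]]|ab].
  have dA : max_deg A = n.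
    move/(congr1 size): hA.
    by rewrite size_mkseq /= size_rcons size_nseq prednK // => -[].
  have hd d : 0 < d < n -> #|` graded A d| = a.
    move=> /andP[d0 dn]; rewrite -nth_h_vector ?dA ?(ltnW dn) // hA.
    case: d d0 dn => // d _ dn.
    by rewrite /= nth_rcons size_nseq nth_nseq (_ : d < n.-1) //; lia.
  have hnn : #|` graded A n| = b.
    rewrite -nth_h_vector ?dA // hA; case: n {hn dA hd hA} n0 => // n _ /=.
    by rewrite nth_rcons size_nseq ltnn eqxx.
  have := pure_flat_bounds A; rewrite dA hnn !hd; [|lia|lia].
  by apply.
split; first by rewrite /= all_rcons all_nseq hb ha orbT.
exists a, (star_ideal n a b); have /andP[_ a2b] := ab; split.
- exact: order_ideal_star_ideal.
- exact: pure_star_ideal.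
- exact: h_vector_star_ideal.
Qed.
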